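(* Let $K\ge 1$ be an integer and let $\alpha>0$, $b>0$, $\sigma>0$ be real numbers. Let $L:\mathbb{R}^K\to\mathbb{R}$ be the quadratic loss $L(W)=\frac12 W^{T}AW$ with $A\in\mathbb{R}^{K\times K}$ positive definite. Assume that the quasi-steady-state probability density $$p_{\mathrm{ss}}(W)=C_{1,\mathrm{loc}}\,e^{-\frac{2bL(W)}{\alpha\sigma^2}}$$ on $\mathbb{R}^K$ exists, with normalizing constant $C_{1,\mathrm{loc}}$. Let $\mathbb{E}_{\mathrm{ss}}$ denote expectation with respect to $p_{\mathrm{ss}}$, let $\bar L(W)=L(W)/K$, and let $\bar V(W)$ be the averaged variance of $W$ under $p_{\mathrm{ss}}$, i.e. the total variance divided by $K$. Let the initial parameter have the Gaussian density $$p_0(W)=\frac{1}{(2\pi\sigma_0^2)^{K/2}}e^{-\frac{\|W\|^2}{2\sigma_0^2}},\qquad \sigma_0>0.$$ Then $$\mathbb{E}_{\mathrm{ss}}[\bar L(W)]\le \frac{\alpha\sigma^2}{4b}\left[\log\left(\frac{\mathbb{E}_{\mathrm{ss}}[\|W\|^2]}{K}\right)+\log\left(2\pi e\,C_{1,\mathrm{loc}}\right)\right],$$ provided that the optimal standard deviation of the initial distribution is given by $$\sigma_0=\sqrt{\frac{\mathbb{E}_{\mathrm{ss}}[\|W\|^2]}{K}}=\sqrt{\bar V(W)}.$$ Here ''optimal'' refers to optimizing, with respect to $\sigma_0$, the right-hand side of the bound $$\mathbb{E}_{\mathrm{ss}}[\bar L(W)]\le\frac{\alpha\sigma^2}{2bK}\left[\frac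 K2\log(2\pi\sigma_0^2)+\log(C_{1,\mathrm{loc}})+\frac{\mathbb{E}_{\mathrm{ss}}[\|W\|^2]}{2\sigma_0^2}\right].$$ If one assumes $\mathbb{E}_{\mathrm{ss}}[W]=0$, the optimized bound for the expected value of the loss function is $$\mathbb{E}_{\mathrm{ss}}[\bar L(W)]\le \frac{\alpha\sigma^2}{4b}\left[\log\left(\bar V(W)\right)+\log\left(2\pi e\,C_{1,\mathrm{loc}}\right)\right].$$
   Context: $W\in\mathbb{R}^K$ is the parameter vector of a model trained by stochastic gradient descent with learning rate $\alpha$ and minibatch size $b$, with gradient-noise covariance $\Sigma=\sigma^2 I$. For sufficiently small $\alpha$ the dynamics are approximated in continuous time by $dW^{(t)}=-\nabla L\,dt+\sqrt{\alpha/b}\,\sigma\,dV_t$ with $V_t$ a Wiener process; $p_{\mathrm{ss}}$ is the stationary solution of the associated Fokker-Planck equation near a deep local minimum (placed at $W=0$), where the loss is assumed to be quadratic and the escape time sufficiently large. The initial parameter is distributed according to $p_0$. $\|\cdot\|$ is the Euclidean norm and $\log$ the natural logarithm. $\bar L$ is the loss divided by the number $K$ of parameters.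
   Formalization: The printed optimized bounds fail in general (e.g. K=1, A=1, 2b/(ασ²)>2π). Proved for all parameters with log(2πe C^{2/K}) in place of log(2πe C), C=C_{1,loc}; the printed bounds with C are proved only under the extra hypothesis C^{2/K} ≤ C. *)

(* Defs.v *)
From HB Require Import structures.
From mathcomp Require Import all_boot all_order all_algebra.
From mathcomp Require Import all_classical all_reals all_analysis.
Set Implicit Arguments.
Unset Strict Implicit.
Unset Printing Implicit Defensive.
Import Order.TTheory GRing.Theory Num.Theory.
Import numFieldNormedType.Exports.
Local Open Scope classical_set_scope.
Local Open Scope ring_scope.

(* R^n as a measurable space: the sigma-algebra on tuples generated by the
   coordinates from the Borel sigma-algebra of R is the Borel sigma-algebra. *)
Notation Rn R n := (n.-tuple (measurableTypeR R)).

Section lebesgue_measure_Rn.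
Context {R : realType}.

Section succ.
Context {n : nat} (mu : {sigma_finite_measure set (Rn R n) -> \bar R}).

Definition cons_pair (p : measurableTypeR R * Rn R n) : Rn R n.+1 :=
  [the n.+1.-tuple _ of p.1 :: p.2].

Lemma measurable_cons_pair : measurable_fun setT cons_pair.
Proof. exact: measurable_cons. Qed.

Definition leb_succ : set (Rn R n.+1) -> \bar R :=
  pushforward (@lebesgue_measure R \x mu)%E cons_pair.

Let leb_succ0 : leb_succ set0 = 0%E.
Proof. by rewrite /leb_succ /pushforward preimage_set0 measure0. Qed.

Let leb_succ_ge0 A : (0 <= leb_succ A)%E.
Proof. by rewrite /leb_succ /pushforward measure_ge0. Qed.

Let leb_succ_sigma_additive : semi_sigma_additive leb_succ.
Proof.
exact: (@measure_semi_sigma_additive _ _ _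
  (measure_function_pushforward__canonical__measure_function_Measure
     (@lebesgue_measure R \x mu)%E measurable_cons_pair)).
Qed.

HB.instance Definition _ := isMeasure.Build _ _ _ leb_succ
  leb_succ0 leb_succ_ge0 leb_succ_sigma_additive.

Lemma leb_succ_sigma_finite : sigma_finite setT leb_succ.
Proof.
have /sigma_finiteP[F [FT ndF Ffin]] := sigma_finiteT (@lebesgue_measure R).
have /sigma_finiteP[G [GT ndG Gfin]] := sigma_finiteT mu.
exists (fun k => [set t | F k (thead t) /\ G k [tuple of behead t]]).
  apply/seteqP; split=> // t _.
  have : setT (thead t) by [].
  rewrite FT => -[i _ Fi].
  have : setT [tuple of behead t] by [].
  rewrite GT => -[j _ Gj].
  exists (maxn i j) => //; split.
    by move: Fi; exact/subsetPset/ndF/leq_maxl.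
  by move: Gj; exact/subsetPset/ndG/leq_maxr.
move=> k; have [mF Foo] := Ffin k; have [mG Goo] := Gfin k; split.
  apply: measurableI.
    rewrite -[X in measurable X]setTI.
    exact: (@measurable_tnth _ (measurableTypeR R) n.+1 ord0).
  rewrite -[X in measurable X]setTI.
  exact: (@measurable_behead _ (measurableTypeR R) n).
rewrite /leb_succ /pushforward (_ : _ @^-1` _ = F k `*` G k).
  by rewrite product_measure1E// lte_mul_pinfty// ge0_fin_numE.
have bK x (t : Rn R n) : [tuple of behead (cons_pair (x, t))] = t :> n.-tuple _.
  exact/val_inj.
by apply/seteqP; split=> -[x t] /=; rewrite bK theadE.
Qed.

HB.instance Definition _ :=
  Measure_isSigmaFinite.Build _ _ _ leb_succ leb_succ_sigma_finite.

End succ.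

(* n-dimensional Lebesgue measure, as an iterated product. *)
Fixpoint lebesgue_Rn (n : nat) : {sigma_finite_measure set (Rn R n) -> \bar R} :=
  match n return {sigma_finite_measure set (Rn R n) -> \bar R} with
  | 0%N => @dirac _ (Rn R 0) [tuple] R
  | m.+1 => leb_succ (lebesgue_Rn m)
  end.

End lebesgue_measure_Rn.

Section model.
Context {R : realType} {K : nat}.
Implicit Types (W : Rn R K) (P : probability (Rn R K) R).

Definition is_density P (p : Rn R K -> R) :=
  forall S, measurable S -> P S = (\int[lebesgue_Rn K]_(W in S) (p W)%:E)%E.

Definition colvec W : 'cV[R]_K := \col_i tnth W i.

(* Symmetry is not required: only the symmetric part of A enters the loss, so
   the symmetric case is covered. *)
Definition posdef (A : 'M[R]_K) :=
  forall x : 'cV[R]_K, x != 0 -> 0 < (x^T *m A *m x) 0 0.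

Definition loss (A : 'M[R]_K) W : R :=
  2^-1 * ((colvec W)^T *m A *m colvec W) 0 0.

Definition mean_loss (A : 'M[R]_K) W : R := loss A W / K%:R.

Definition sqnorm W : R := \sum_(i < K) (tnth W i : R) ^+ 2.

Definition p_ss (alpha b sigma : R) (A : 'M[R]_K) (C1loc : R) W : R :=
  C1loc * expR (- (2 * b * loss A W / (alpha * sigma ^+ 2))).

Definition p_0 (sigma0 : R) W : R :=
  ((2 * pi * sigma0 ^+ 2) `^ (K%:R / 2))^-1
  * expR (- (sqnorm W / (2 * sigma0 ^+ 2))).

(* For P with density p_ss, all expectations and variances used are finite
   (Gaussian tails), so fine loses nothing. *)
Definition expect P (f : Rn R K -> R) : R := fine ('E_P[f])%E.

Definition mean_zero P := forall i : 'I_K, expect P (fun W => tnth W i) = 0.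

Definition avg_variance P : R :=
  (\sum_(i < K) fine ('V_P[fun W : Rn R K => (tnth W i : R)])%E) / K%:R.

(* m2 stands for the second moment E_ss[||W||^2]. *)
Definition init_bound (alpha b sigma C1loc m2 s : R) : R :=
  alpha * sigma ^+ 2 / (2 * b * K%:R)
  * (K%:R / 2 * ln (2 * pi * s ^+ 2) + ln C1loc + m2 / (2 * s ^+ 2)).

End model.

Arguments init_bound {R} K.

Definition optimal_std {R : realType} (f : R -> R) (s : R) :=
  0 < s /\ forall s', 0 < s' -> f s <= f s'.

(* With s ^ 2 = v = m2 / K, init_bound equals optimized_bound at
   c = C1loc `^ (2 / K): the term log C1loc has the prefactor
   alpha sigma^2 / (2 b K), i.e. weight 2 / K relative to alpha sigma^2 / (4 b).
   Hence c = C1loc gives the minimum only if K = 2 or C1loc = 1, and it is an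
   upper bound as soon as C1loc `^ (2 / K) <= C1loc (K = 1 and C1loc <= 1; or
   K = 2; or K > 2 and C1loc >= 1, i.e., for symmetric A,
   (2 b / (alpha sigma^2)) ^ K \det A >= (2 pi) ^ K).
   In general it is not: for K = 1, A = 1 and 2 b / (alpha sigma^2) = m, one has
   C1loc = sqrt (m / (2 pi)), v = 1 / m and E[L] = 1 / (2 m), whereas
   c = C1loc gives (1 - log (m / (2 pi)) / 2) / (2 m) < 1 / (2 m) for
   m > 2 pi. *)
Definition optimized_bound {R : realType} (alpha b sigma c v : R) : R :=
  alpha * sigma ^+ 2 / (4 * b) * (ln v + ln (2 * pi * expR 1 * c)).

(* Main.v *)
(* The stationary law Pss has density p = C1loc exp(- q L) with
   q = 2 b / (alpha sigma^2). Gibbs' inequality E_ss[ln (p_0 / p)] <= 0, applied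
   with the Gaussian density p_0 of any standard deviation s > 0, reads
     q E_ss[L] <= (K / 2) ln (2 pi s^2) + ln C1loc + E_ss[||W||^2] / (2 s^2),
   which is the bound to be optimized. As its left-hand side is nonnegative for
   every s, letting s tend to 0 shows E_ss[||W||^2] > 0. Put
   v = E_ss[||W||^2] / K: the excess of the bound over its value at s = sqrt v
   is a positive multiple of t - 1 - ln t for t = v / s^2, so sqrt v is the
   unique minimizer. Finally E_ss[W] = 0 holds by the symmetry W -> - W, whence
   v is the averaged variance. *)
Require Import Defs.
From HB Require Import structures.
From mathcomp Require Import all_boot all_order all_algebra.
From mathcomp Require Import all_classical all_reals all_analysis.
From mathcomp Require Import measurable_realfun ring lra.
Set Implicit Arguments.
Unset Strict Implicit.
Unset Printing Implicit Defensive.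
Import Order.TTheory GRing.Theory Num.Theory.
Import numFieldNormedType.Exports.
Local Open Scope classical_set_scope.
Local Open Scope ring_scope.

(** * The tangent inequality for the logarithm *)

Lemma ln_le_subr1 (R : realType) (x : R) : 0 < x -> ln x <= x - 1.
Proof.
move=> x0; rewrite -[X in ln X](subrK 1) addrC.
by apply: le_ln1Dx; rewrite ltrBrDr addrC subrr.
Qed.

(** Equality case of the tangent inequality: 1 + y < exp y unless y = 0, taken at y = ln x. It
    yields uniqueness of the minimizer. *)
Lemma subr1_le_ln (R : realType) (x : R) : 0 < x -> x - 1 <= ln x -> x = 1.
Proof.
move=> x0 xl; apply/eqP; rewrite -ln_eq0//.
apply: contraTT xl => /expR_gt1Dx; rewrite -ltNge lnK ?posrE//.
by rewrite addrC ltrBrDr.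
Qed.

(** * Integration against Lebesgue measure on R^n *)

(** Tonelli's theorem, transported along [cons_pair]; this is the inductive step for integrals over
    R^n. *)
Lemma integral_lebesgue_RnS (R : realType) n (f : Rn R n.+1 -> \bar R) :
  measurable_fun [set: Rn R _] f -> (forall t, 0 <= f t)%E ->
  (\int[lebesgue_Rn n.+1]_t f t =
   \int[@lebesgue_measure R]_x \int[lebesgue_Rn n]_t f (cons_pair (x, t)))%E.
Proof.
move=> mf f0.
rewrite [LHS](@ge0_integral_pushforward _ _ _ _ _ _ measurable_cons_pair)//.
rewrite preimage_setT (fubini_tonelli1 (f \o cons_pair))//; last first.
  by move=> p; exact: f0.
by apply: measurableT_comp => //; exact: measurable_cons_pair.
Qed.

Definition oppRn {R : realType} {n} (t : Rn R n) : Rn R n :=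
  [tuple - tnth t i | i < n].

Lemma measurable_oppRn (R : realType) n : measurable_fun setT (@oppRn R n).
Proof.
apply/measurable_fun_tnthP => i.
rewrite (_ : _ \o _ = -%R \o (@tnth n R ^~ i)); last first.
  by apply/funext => t /=; rewrite tnth_mktuple.
by apply: measurableT_comp => //; exact: measurable_tnth.
Qed.

Lemma oppRn_cons (R : realType) n (x : R) (t : Rn R n) :
  oppRn (cons_pair (x, t)) = cons_pair (- x, oppRn t).
Proof.
apply: eq_from_tnth => i; rewrite tnth_mktuple /cons_pair /=.
case: (fintype.unliftP ord0 i) => [j ->|->]; last by [].
by rewrite !tnthS tnth_mktuple.
Qed.

(** Induction on the dimension: the hypothesis reflects the inner integral over the tail, and
    invariance of one-dimensional Lebesgue measure reflects the outer one. *)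
Lemma integral_lebesgue_RnN (R : realType) n (f : Rn R n -> \bar R) :
  measurable_fun [set: Rn R _] f -> (forall t, 0 <= f t)%E ->
  (\int[lebesgue_Rn n]_t f (oppRn t) = \int[lebesgue_Rn n]_t f t)%E.
Proof.
elim: n f => [|n IHn] f mf f0.
  by apply: eq_integral => t _; rewrite (tuple0 (oppRn t)) (tuple0 t).
have mfN : measurable_fun setT (f \o @oppRn R n.+1).
  by apply: measurableT_comp => //; exact: measurable_oppRn.
rewrite (integral_lebesgue_RnS mf f0) [LHS](integral_lebesgue_RnS mfN);
  last by move=> t; exact: f0.
pose g (x : measurableTypeR R) :=
  (\int[lebesgue_Rn n]_t f (cons_pair (x, t)))%E.
have mfc : measurable_fun setT (f \o @cons_pair R n).
  by apply: measurableT_comp => //; exact: measurable_cons_pair.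
have mg : measurable_fun setT g.
  by apply: (measurable_fun_fubini_tonelli_F _ mfc) => p; exact: f0.
transitivity (\int[@lebesgue_measure R]_x g (- x)%R)%E.
  apply: eq_integral => x _; rewrite /g.
  rewrite -[RHS]IHn//.
    by apply: eq_integral => t _ /=; rewrite oppRn_cons.
  exact: (measurableT_comp mfc (measurable_pair1 _)).
have g0 x : (0 <= g x)%E by exact: integral_ge0.
have mN : measurable_fun setT
  (-%R : measurableTypeR R -> measurableTypeR R) by [].
rewrite -[LHS](ge0_integral_pushforward mN lebesgue_measure measurableT mg)//.
apply: eq_measure_integral => //= A mA _; exact: lebesgue_measureN.
Qed.

Lemma integral_lebesgue_Rn_prod (R : realType) n (g : R -> R) (c : R) :
  measurable_fun setT g -> (forall x, 0 <= g x) ->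
  (\int[@lebesgue_measure R]_x (g x)%:E = c%:E)%E ->
  (\int[@lebesgue_Rn R n]_t (\prod_(i < n) g (tnth t i))%:E = (c ^+ n)%:E)%E.
Proof.
move=> mg g0 gc.
have mprod m : measurable_fun setT
    (fun t : Rn R m => (\prod_(i < m) g (tnth t i))%:E).
  apply/measurable_EFinP; apply: measurable_prod => i _.
  by apply: measurableT_comp => //; exact: measurable_tnth.
elim: n => [|n IHn].
  under eq_integral do rewrite big_ord0.
  (* R^0 carries the unit mass at the empty tuple, and the empty product is 1 = c^0. *)
  by rewrite integral_cst// /= diracT mule1 expr0.
rewrite integral_lebesgue_RnS//; last first.
  by move=> t; rewrite lee_fin prodr_ge0.
transitivity (\int[@lebesgue_measure R]_x ((g x)%:E * (c ^+ n)%:E))%E.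
  apply: eq_integral => x _; rewrite -IHn -ge0_integralZl//=; last 3 first.
  - exact: mprod.
  - by move=> t _; rewrite lee_fin prodr_ge0.
  - by rewrite lee_fin.
  apply: eq_integral => t _; rewrite big_ord_recl EFinM.
  by congr (_ * (_)%:E)%E; apply: eq_bigr => i _; rewrite tnthS.
rewrite ge0_integralZr//.
- by rewrite gc -EFinM exprS.
- exact/measurable_EFinP.
- by move=> x _; rewrite lee_fin.
- rewrite -IHn; apply: integral_ge0 => t _; by rewrite lee_fin prodr_ge0.
Qed.

(** * Integration against a density; the Gaussian density *)

(** [is_density] only prescribes measures of sets. It makes [P] absolutely continuous, and [p]
    agrees almost everywhere with the Radon-Nikodym derivative because both have the same integral
    over every measurable set. *)
Lemma ge0_integral_density (R : realType) K (P : probability (Rn R K) R) p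
    (f : Rn R K -> \bar R) :
  is_density P p -> measurable_fun setT p -> (forall t, 0 <= p t) ->
  measurable_fun [set: Rn R _] f -> (forall t, 0 <= f t)%E ->
  (\int[P]_t f t = \int[lebesgue_Rn K]_t (f t * (p t)%:E))%E.
Proof.
move=> dP mp p0 mf f0.
have mpE : measurable_fun setT (EFin \o p) by exact/measurable_EFinP.
have Pmu : P `<< lebesgue_Rn K.
  apply/null_content_dominatesP => A mA muA0; rewrite [LHS]dP//.
  by apply: null_set_integral => //; exact: measurable_funTS.
rewrite -(Radon_Nikodym_SigmaFinite.change_of_variables Pmu)//.
apply: ae_eq_integral => //.
- apply: emeasurable_funM => //.
  exact: measurable_int (Radon_Nikodym_SigmaFinite.f_integrable _).
- exact: emeasurable_funM.
- apply: ae_eqe_mul2l; apply: integral_ae_eq => //.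
  + exact: Radon_Nikodym_SigmaFinite.f_integrable.
  + move=> A _ mA; rewrite -Radon_Nikodym_SigmaFinite.f_integral//.
    exact: dP.
Qed.

(** The density factors into [K] one-dimensional normal densities, each of integral 1. *)
Lemma integral_p_0 (R : realType) K (s : R) : 0 < s ->
  (\int[@lebesgue_Rn R K]_t (p_0 s t)%:E = 1)%E.
Proof.
move=> s0; have sN0 : s != 0 by rewrite gt_eqF.
have := @integral_lebesgue_Rn_prod R K (normal_pdf 0 s) 1
  (measurable_normal_pdf 0 s) (normal_pdf_ge0 0 s) (integral_normal_pdf 0 s).
rewrite expr1n => <-; apply: eq_integral => t _; congr (_)%:E.
under eq_bigr do rewrite normal_pdfE// /normal_fun subr0.
rewrite big_split /= prodr_const card_ord -expR_sum; congr (_ * expR _).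
  have s2 : 0 <= 2 * pi * s ^+ 2 by rewrite !mulr_ge0 ?pi_ge0// ltW.
  rewrite /normal_peak exprVn; congr (_^-1).
  rewrite [K%:R / 2]mulrC powRrM powR12_sqrt// powR_mulrn ?sqrtr_ge0//.
  by congr (Num.sqrt _ ^+ _); ring.
rewrite /sqnorm mulr_suml -sumrN; apply: eq_bigr => i _.
by rewrite -[s ^+ 2 *+ 2]mulr_natl mulNr.
Qed.

(** * Positivity and coercivity of the quadratic loss *)

Lemma sqnorm_ge0 (R : realType) K (W : Rn R K) : 0 <= sqnorm W.
Proof. by apply: sumr_ge0 => i _; exact: sqr_ge0. Qed.

Lemma loss_ge0 (R : realType) K (A : 'M[R]_K) (W : Rn R K) :
  posdef A -> 0 <= loss A W.
Proof.
move=> pA; rewrite /loss mulr_ge0//; have [->|W0] := eqVneq (colvec W) 0.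
  by rewrite mulmx0 mxE.
exact/ltW/pA.
Qed.

(* By homogeneity, [l] is the minimum of the loss on the unit sphere. *)
Lemma loss_coercive (R : realType) K (A : 'M[R]_K) : (0 < K)%N -> posdef A ->
  exists2 l : R, 0 < l & forall W : Rn R K, l * sqnorm W <= loss A W.
Proof.
move=> K0 pA.
(* The squared norm and the quadratic form are written as sums over coordinates, so that continuity
   follows term by term. *)
pose n2 (v : 'rV[R]_K) : R := \sum_i v 0 i * v 0 i.
pose q (v : 'rV[R]_K) : R := \sum_i (\sum_j v 0 j * A j i) * v 0 i.
have qE v : q v = (v *m A *m v^T) 0 0.
  by rewrite mxE; apply: eq_bigr => i _; rewrite !mxE.
have cadd : continuous (fun x : R * R => x.1 + x.2) by exact: add_continuous.
have cc i : continuous (fun v : 'rV[R]_K => v 0 i) by exact: coord_continuous.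
have cn2 : continuous n2.
  apply: continuous_big => // i _ v.
  by apply: continuousM; exact: cc.
have cq : continuous q.
  apply: continuous_big => // i _ v.
  apply: continuousM; last exact: cc.
  apply: continuous_big => // j _ w.
  by apply: continuousM; [exact: cc|exact: cst_continuous].
pose S := n2 @^-1` [set 1].
have S0 : S !=set0.
  exists (delta_mx 0 (Ordinal K0)); rewrite /S /= /n2 (bigD1 (Ordinal K0))//=.
  rewrite mxE !eqxx mul1r big1 ?addr0// => i iK.
  by rewrite mxE eqxx (negbTE iK) mul0r.
have cS : compact S.
  have Sclosed : closed S.
    by apply: preimage_closed; [move=> x _; exact: cn2|exact: closed_eq].
  (* The unit sphere is a closed subset of the compact cube [-1, 1]^K. *)
  have cI := @rV_compact R K (fun=> `[-1, 1]%classic)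
    (fun=> @segment_compact R (-1) 1).
  apply: (subclosed_compact Sclosed cI) => v Sv i.
  rewrite /= in_itv /= -ler_norml -(@ler_pXn2r _ 2)// ?nnegrE// expr1n.
  rewrite real_normK ?num_real// expr2.
  rewrite -Sv /n2 (bigD1 i)//= lerDl sumr_ge0// => j _.
  by rewrite -expr2 sqr_ge0.
have [u uS umin] := EVT_min_rV S0 cS (continuous_subspaceT cq).
have u0 : u^T != 0.
  apply: contraTneq uS => uT0; rewrite notin_setE /S /= /n2 big1 ?eqxx.
    by move/eqP; rewrite eq_sym oner_eq0.
  move=> i _; move: (congr1 (fun M : 'cV_K => M i 0) uT0); rewrite !mxE => ->.
  by rewrite mul0r.
have qu : 0 < q u by rewrite qE -[u in u *m A]trmxK; exact: pA.
(* [u] minimizes [q] on the sphere and [q] is twice the loss, whence the factor 1/2. *)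
exists (2^-1 * q u) => [|W]; first by rewrite mulr_gt0.
have NE : n2 (colvec W)^T = sqnorm W.
  by apply: eq_bigr => i _; rewrite !mxE -expr2.
have qW : q (colvec W)^T = 2 * loss A W.
  by rewrite qE trmxK mulrA divff// mul1r.
have [N0|N0] := leP (sqnorm W) 0.
  apply: le_trans (loss_ge0 W pA).
  by rewrite pmulr_rle0// mulr_gt0.
pose a := (Num.sqrt (sqnorm W))^-1.
have a2 : a * a = (sqnorm W)^-1 by rewrite -invfM -expr2 sqr_sqrtr// ltW.
have qZ v : q (a *: v) = a * a * q v.
  by rewrite !qE linearZ /= -!scalemxAl -scalemxAr scalerA mxE.
have n2Z v : n2 (a *: v) = a * a * n2 v.
  by rewrite /n2 mulr_sumr; apply: eq_bigr => i _; rewrite !mxE mulrACA.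
have /umin : a *: (colvec W)^T \in S.
  by rewrite inE /S /= n2Z NE a2 mulVf// gt_eqF.
rewrite qZ qW a2 mulrC ler_pdivlMr// => h.
by rewrite -mulrA ler_pdivrMl.
Qed.

(** * Measurability of the norm, the loss and the Gaussian density *)

Lemma measurable_coord (R : realType) K (i : 'I_K) :
  measurable_fun [set: Rn R K] (fun W => tnth W i : R).
Proof. exact: measurable_tnth. Qed.

Lemma measurable_sqnorm (R : realType) K : measurable_fun [set: Rn R K] sqnorm.
Proof.
apply: measurable_sum => i; apply: measurable_funX; exact: measurable_coord.
Qed.

Lemma measurable_loss (R : realType) K (A : 'M[R]_K) :
  measurable_fun [set: Rn R K] (loss A).
Proof.
have -> : loss A = fun W => 2^-1 * \sum_i (\sum_j tnth W j * A j i) * tnth W i.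
  apply/funext => W; rewrite /loss mxE; congr (_ * _).
  apply: eq_bigr => i _; rewrite !mxE; congr (_ * _).
  by apply: eq_bigr => j _; rewrite !mxE.
apply: measurable_funM => //; apply: measurable_sum => i.
apply: measurable_funM; last exact: measurable_coord.
apply: measurable_sum => j.
by apply: measurable_funM => //; exact: measurable_coord.
Qed.

Lemma measurable_p_0 (R : realType) K (s : R) :
  measurable_fun [set: Rn R K] (p_0 s).
Proof.
apply: measurable_funM => //; apply: measurableT_comp => //.
apply: measurableT_comp => //; apply: measurable_funM => //.
exact: measurable_sqnorm.
Qed.

Lemma p_0_gt0 (R : realType) K (s : R) (W : Rn R K) : 0 < s -> 0 < p_0 s W.
Proof.
move=> s0; rewrite mulr_gt0 ?expR_gt0// invr_gt0 powR_gt0//.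
by rewrite !mulr_gt0 ?pi_gt0// exprn_gt0.
Qed.

(** * Expectations of odd functions and Gibbs' inequality *)

Lemma expectE (R : realType) K (P : probability (Rn R K) R)
    (f : Rn R K -> R) :
  expect P f = (\int[P]_W f W)%R.
Proof. by rewrite /expect unlock. Qed.

(** The reflection W -> - W preserves the density and exchanges the positive and negative parts of
    [f], so these have equal integrals. *)
Lemma expect_odd (R : realType) K (P : probability (Rn R K) R) p
    (f : Rn R K -> R) :
  is_density P p -> measurable_fun [set: Rn R K] p -> (forall W, 0 <= p W) ->
  (forall W, p (oppRn W) = p W) ->
  measurable_fun [set: Rn R K] f -> (forall W, f (oppRn W) = - f W) ->
  expect P f = 0.
Proof.
move=> dP mp p0 peven mf fodd; rewrite /expect unlock integralE.
set F := fun W => (f W)%:E.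
have mF : measurable_fun [set: Rn R K] F by exact/measurable_EFinP.
have FN W : (F^\- W = F^\+ (oppRn W))%E.
  by rewrite funenegE funeposE /F fodd.
have -> : (\int[P]_W F^\- W = \int[P]_W F^\+ W)%E.
  rewrite !(ge0_integral_density dP)//; last 2 first.
  - exact: measurable_funepos.
  - exact: measurable_funeneg.
  rewrite -[RHS]integral_lebesgue_RnN.
  - by apply: eq_integral => W _; rewrite FN peven.
  - apply: emeasurable_funM; first exact: measurable_funepos.
    exact/measurable_EFinP.
  - by move=> W; rewrite mule_ge0// lee_fin.
(* If both parts have infinite integral, [fine (+oo - +oo) = 0] as well. *)
by case: (\int[P]_W F^\+ W)%E => //= r; rewrite subrr.
Qed.

(* Gibbs' inequality, from [ln x <= x - 1] at [x = r / p]. *)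
Lemma expect_ln_ratio_le0 (R : realType) K (P : probability (Rn R K) R)
    (p r : Rn R K -> R) :
  is_density P p -> measurable_fun [set: Rn R K] p -> (forall W, 0 < p W) ->
  (forall W, 0 < r W) ->
  (\int[lebesgue_Rn K]_W (r W)%:E = 1)%E ->
  P.-integrable setT (fun W => (ln (r W / p W))%:E) ->
  expect P (fun W => ln (r W / p W)) <= 0.
Proof.
move=> dP mp p0 r0 r1 il; rewrite expectE.
have rp0 W : 0 < r W / p W by rewrite divr_gt0.
(* The ratio is the exponential of its logarithm, which is measurable because it is integrable. *)
have mrp : measurable_fun [set: Rn R K] (fun W => r W / p W).
  have -> : (fun W => r W / p W) = expR \o (fun W => ln (r W / p W)).
    by apply/funext => W /=; rewrite lnK// posrE.
  apply: measurableT_comp => //.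
  by apply/measurable_EFinP; exact: measurable_int il.
(* Under [P] the factor [p] cancels and the total mass of [r] remains. *)
have rp1 : (\int[P]_W (r W / p W)%:E = 1)%E.
  rewrite (ge0_integral_density dP)//.
  - rewrite -r1; apply: eq_integral => W _.
    by rewrite -EFinM divfK// gt_eqF.
  - by move=> W; exact: ltW.
  - exact/measurable_EFinP.
  - by move=> W; rewrite lee_fin ltW.
have irp : P.-integrable setT (EFin \o (fun W => r W / p W)).
  apply/integrableP; split; first exact/measurable_EFinP.
  under eq_integral do rewrite /= ger0_norm ?ltW//.
  by rewrite rp1 ltry.
have i1 : P.-integrable setT (EFin \o cst (1 : R)).
  exact: finite_measure_integrable_cst.
apply: (@le_trans _ _ (\int[P]_W (r W / p W - 1))%R).
  apply: le_Rintegral => //; first exact: (integrableB measurableT irp i1).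
  by move=> W _; exact: ln_le_subr1.
rewrite RintegralB// Rintegral_cst//.
rewrite [X in fine X](_ : _ = 1%E); last exact: probability_setT.
by rewrite /Rintegral rp1 /= mulr1 subrr.
Qed.

(** * Moments and the entropy bound under the density C exp(- q L) *)

Section gibbs_measure.
Context {R : realType} {K : nat}.
Variables (q C : R) (A : 'M[R]_K) (P : probability (Rn R K) R).
Hypotheses (K0 : (0 < K)%N) (q0 : 0 < q) (pA : posdef A).
Let p (W : Rn R K) := C * expR (- (q * loss A W)).
Hypothesis dP : is_density P p.

Let mp : measurable_fun [set: Rn R K] p.
Proof.
apply: measurable_funM => //; apply: measurableT_comp => //.
apply: measurableT_comp => //; apply: measurable_funM => //.
exact: measurable_loss.
Qed.

(** For C <= 0 the density would be nonpositive everywhere, against total mass 1. *)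
Lemma normalizing_constant_gt0 : 0 < C.
Proof.
rewrite ltNge; apply/negP => C0.
have pN W : 0 <= - p W by rewrite oppr_ge0 mulr_le0_ge0// expR_ge0.
have := dP measurableT; rewrite probability_setT.
have -> : (\int[lebesgue_Rn K]_W (p W)%:E =
    - \int[lebesgue_Rn K]_W (- p W)%:E)%E.
  rewrite -integral_ge0N => [|W _]; last by rewrite lee_fin.
  by apply: eq_integral => W _; rewrite EFinN oppeK.
move=> p1; have : (0 <= \int[lebesgue_Rn K]_W (- p W)%:E)%E.
  by apply: integral_ge0 => W _; rewrite lee_fin.
by rewrite -leeN2 -p1 oppe0 lee_fin ler10.
Qed.

Let C0 : 0 < C := normalizing_constant_gt0.

Let p0 W : 0 < p W.
Proof. by rewrite mulr_gt0// expR_gt0. Qed.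

Lemma integrable_loss : P.-integrable setT (EFin \o loss A).
Proof.
have [l l0 lW] := loss_coercive K0 pA.
(* With s^2 = 1 / (q l), the Gaussian exponent ||W||^2 / (2 s^2) equals (q / 2) l ||W||^2, which is
   at most q L / 2 by coercivity. *)
pose s := Num.sqrt (q * l)^-1.
have ql0 : 0 < (q * l)^-1 by rewrite invr_gt0 mulr_gt0.
have s0 : 0 < s by rewrite sqrtr_gt0.
have s2 : s ^+ 2 = (q * l)^-1 by rewrite sqr_sqrtr// ltW.
have Z0 : 0 < (2 * pi * s ^+ 2) `^ (K%:R / 2).
  by rewrite powR_gt0// !mulr_gt0 ?pi_gt0// exprn_gt0.
(* The last factor of [M] cancels the normalization of [p_0 s]; the factor 2 / q bounds L exp(- q L
   / 2). *)
pose M := C * (2 / q) * (2 * pi * s ^+ 2) `^ (K%:R / 2).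
have M0 : 0 <= M by rewrite !mulr_ge0// ltW// invr_gt0.
have mL : measurable_fun [set: Rn R K] (EFin \o loss A).
  by apply/measurable_EFinP; exact: measurable_loss.
have mp0 : measurable_fun [set: Rn R K] (fun W => (p_0 s W)%:E).
  by apply/measurable_EFinP; exact: measurable_p_0.
apply/integrableP; split; first exact: mL.
under eq_integral do rewrite /= ger0_norm ?loss_ge0//.
rewrite (ge0_integral_density dP)//; last 2 first.
- by move=> W; exact: ltW.
- by move=> W; rewrite lee_fin loss_ge0.
(* [L exp(- q L) <= (2 / q) exp(- q L / 2)] is dominated by a Gaussian. *)
apply: (@le_lt_trans _ _ (\int[lebesgue_Rn K]_W (M%:E * (p_0 s W)%:E))%E).
  apply: ge0_le_integral => //.
  - by move=> W _; rewrite mule_ge0// lee_fin ?loss_ge0// ltW.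
  - by apply: emeasurable_funM => //; exact/measurable_EFinP.
  - exact: emeasurable_funM.
  - move=> W _; rewrite -!EFinM lee_fin /M /p_0 /p.
    set Z := _ `^ _; set e := expR (- (sqnorm _ / _)).
    have -> : C * (2 / q) * Z * (Z^-1 * e) = C * (2 / q * e).
      by field; rewrite !gt_eqF.
    rewrite mulrCA ler_pM2l// /e s2.
    have -> : sqnorm W / (2 * (q * l)^-1) = q / 2 * (l * sqnorm W).
      by field; rewrite !gt_eqF.
    apply: (@le_trans _ _ (2 / q * expR (- (q / 2 * loss A W)))); last first.
      rewrite ler_pM2l ?divr_gt0// ler_expR lerN2 ler_pM2l ?divr_gt0//.
    have -> : - (q * loss A W) = - (q / 2 * loss A W) - q / 2 * loss A W.
      by field.
    (* What remains is q L / 2 <= exp(q L / 2), from 1 + x <= exp x. *)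
    rewrite expRD mulrA ler_pM2r ?expR_gt0// expRN ler_pdivrMr ?expR_gt0//.
    rewrite -[2 / q]invf_div ler_pdivlMl ?divr_gt0//.
    by apply: le_trans (expR_ge1Dx _); rewrite lerDr.
rewrite ge0_integralZl//.
- by rewrite integral_p_0// mule1 ltry.
- by move=> W _; rewrite lee_fin ltW// p_0_gt0.
Qed.

(** By coercivity ||W||^2 is dominated by L / l. *)
Lemma integrable_sqnorm : P.-integrable setT (EFin \o sqnorm).
Proof.
have [l l0 lW] := loss_coercive K0 pA.
have iL : P.-integrable setT (EFin \o (fun W => l^-1 * loss A W)).
  exact: (integrableZl measurableT l^-1 integrable_loss).
apply: le_integrable iL => //.
  by apply/measurable_EFinP; exact: measurable_sqnorm.
move=> W _; rewrite /= lee_fin ger0_norm ?sqnorm_ge0//.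
rewrite ger0_norm; last by rewrite pmulr_rge0 ?invr_gt0// loss_ge0.
by rewrite ler_pdivlMl.
Qed.

Lemma integrable_coord_sqr (i : 'I_K) :
  P.-integrable setT (fun W : Rn R K => (tnth W i ^+ 2 : R)%:E).
Proof.
apply: le_integrable integrable_sqnorm => //.
  by apply/measurable_EFinP; apply: measurable_funX; exact: measurable_coord.
move=> W _; rewrite /= lee_fin !ger0_norm ?sqnorm_ge0 ?sqr_ge0//.
by rewrite /sqnorm (bigD1 i)//= lerDl sumr_ge0// => j _; exact: sqr_ge0.
Qed.

(** Gibbs' inequality with r = [p_0 s]: the logarithm of the ratio is an affine combination of the
    loss and ||W||^2, both integrable, so its expectation splits. *)
Lemma relative_entropy_bound s : 0 < s ->
  q * expect P (loss A) <=
  K%:R / 2 * ln (2 * pi * s ^+ 2) + ln C + expect P sqnorm / (2 * s ^+ 2).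
Proof.
move=> s0; have s2 : 0 < s ^+ 2 by rewrite exprn_gt0.
have ps2 : 0 < 2 * pi * s ^+ 2 by rewrite !mulr_gt0 ?pi_gt0.
set c := K%:R / 2 * ln (2 * pi * s ^+ 2) + ln C.
pose k := (2 * s ^+ 2)^-1.
have lnE : (fun W => ln (p_0 s W / p W)) =
    (fun W => q * loss A W - k * sqnorm W - c).
  apply/funext => W; rewrite ln_div ?posrE ?p_0_gt0// /p_0 /p.
  rewrite !lnM ?posrE ?expR_gt0 ?invr_gt0 ?powR_gt0// lnV ?posrE ?powR_gt0//.
  by rewrite !expRK ln_powR /c /k; lra.
have iL : P.-integrable setT (EFin \o (fun W => q * loss A W)).
  exact: (integrableZl measurableT q integrable_loss).
have iN : P.-integrable setT (EFin \o (fun W => k * sqnorm W)).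
  exact: (integrableZl measurableT k integrable_sqnorm).
have ic : P.-integrable setT (EFin \o cst c).
  exact: finite_measure_integrable_cst.
have iLN : P.-integrable setT (EFin \o (fun W => q * loss A W - k * sqnorm W)).
  exact: (integrableB measurableT iL iN).
have := @expect_ln_ratio_le0 R K P p (p_0 s) dP mp p0 (fun W => p_0_gt0 W s0)
  (integral_p_0 K s0).
have -> : (fun W => (ln (p_0 s W / p W))%:E) =
    EFin \o (fun W => q * loss A W - k * sqnorm W - c) by rewrite -lnE.
rewrite lnE => /(_ (integrableB measurableT iLN ic)).
rewrite !expectE RintegralB// RintegralB//.
rewrite (RintegralZl _ measurableT integrable_loss).
rewrite (RintegralZl _ measurableT integrable_sqnorm).
rewrite Rintegral_cst//.
rewrite [X in fine X](_ : _ = 1%E); last exact: probability_setT.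
by rewrite mulr1 /k /=; lra.
Qed.

Lemma expect_sqnorm_gt0 : 0 < expect P sqnorm.
Proof.
rewrite ltNge; apply/negP => m0.
have KR : 0 < K%:R :> R by rewrite ltr0n.
(* One explicit [s] replaces the limit s -> 0: with 2 pi s^2 = y one has (K / 2) ln y + ln C = - 1.
   If the second moment were nonpositive, the bound would be at most - 1, although q E[L] >= 0. *)
pose y := expR (- (2 / K%:R * (ln C + 1))).
have y0 : 0 < y / (2 * pi) by rewrite divr_gt0 ?expR_gt0// mulr_gt0 ?pi_gt0.
have s0 : 0 < Num.sqrt (y / (2 * pi)) by rewrite sqrtr_gt0.
have := relative_entropy_bound s0; rewrite (sqr_sqrtr (ltW y0)).
have -> : 2 * pi * (y / (2 * pi)) = y.
  by rewrite mulrC divfK// gt_eqF// mulr_gt0// pi_gt0.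
rewrite expRK.
have -> : K%:R / 2 * - (2 / K%:R * (ln C + 1)) = - (ln C + 1).
  by field; rewrite gt_eqF.
have : 0 <= q * expect P (loss A).
  rewrite mulr_ge0 ?(ltW q0)// expectE Rintegral_ge0// => W _.
  exact: loss_ge0.
have : expect P sqnorm / (2 * (y / (2 * pi))) <= 0.
  by rewrite mulr_le0_ge0// invr_ge0 mulr_ge0 ?(ltW y0).
by lra.
Qed.

Lemma expect_coord (i : 'I_K) : expect P (fun W => tnth W i) = 0.
Proof.
apply: (expect_odd dP) => //.
- by move=> W; exact: ltW.
- move=> W; rewrite /p /loss; congr (_ * expR (- (_ * (_ * _)))).
  have -> : colvec (oppRn W) = - colvec W.
    by apply/colP => j; rewrite !mxE tnth_mktuple.
  by rewrite [(- _)^T]linearN mulNmx mulmxN mulNmx opprK.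
- exact: measurable_coord.
- by move=> W; rewrite tnth_mktuple.
Qed.

Lemma avg_varianceE : avg_variance P = expect P sqnorm / K%:R.
Proof.
congr (_ / _).
transitivity (\sum_(i < K) fine (\int[P]_W (tnth W i ^+ 2 : R)%:E)).
  apply: eq_bigr => i _; rewrite /variance unlock.
  have := expect_coord i; rewrite /expect => ->.
  rewrite unlock; congr fine; apply: eq_integral => W _.
  by rewrite /= !fctE /= subr0 expr2.
(* [fine] commutes with the sum because every second moment is finite. *)
rewrite sum_fine => [|i _]; last first.
  by apply: integrable_fin_num => //; exact: integrable_coord_sqr.
rewrite -integral_sum//; last exact: integrable_coord_sqr.
rewrite expectE; congr fine; apply: eq_integral => W _.
by rewrite /sqnorm sumEFin.
Qed.

End gibbs_measure.

(** * Minimization of the bound over the initial standard deviation *)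

Section init_bound_minimum.
Context {R : realType} (K : nat) (alpha b sigma C m2 : R).
Hypotheses (K0 : (0 < K)%N) (alpha0 : 0 < alpha) (b0 : 0 < b)
  (sigma0 : 0 < sigma) (C0 : 0 < C) (m20 : 0 < m2).
Let f := init_bound K alpha b sigma C m2.
Let v := m2 / K%:R.
Let s0 := Num.sqrt v.
Let kappa := alpha * sigma ^+ 2 / (4 * b).

Let KR : 0 < K%:R :> R. Proof. by rewrite ltr0n. Qed.
Let v0 : 0 < v. Proof. by rewrite divr_gt0. Qed.
Let s0_gt0 : 0 < s0. Proof. by rewrite sqrtr_gt0. Qed.
Let kappa0 : 0 < kappa.
Proof. by rewrite divr_gt0 ?mulr_gt0 ?exprn_gt0. Qed.

(** At s^2 = v the last term of the bound is K / 2. Taking the factor K / 2 out of the bracket turns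
    this term into 1 = ln e and ln C into (2 / K) ln C, hence the power of [C]. *)
Lemma init_bound_sqrt :
  f s0 = optimized_bound alpha b sigma (C `^ (2 / K%:R)) v.
Proof.
have s2 : s0 ^+ 2 = v by rewrite sqr_sqrtr// ltW.
rewrite /f /init_bound /optimized_bound s2.
have pi2 : 0 < 2 * pi :> R by rewrite mulr_gt0 ?pi_gt0.
have -> : ln (2 * pi * v) = ln (2 * pi) + ln v by rewrite lnM ?posrE.
have -> : ln (2 * pi * expR 1 * C `^ (2 / K%:R)) =
    ln (2 * pi) + 1 + 2 / K%:R * ln C.
  rewrite [LHS]lnM ?posrE ?powR_gt0 ?(mulr_gt0 pi2) ?expR_gt0//.
  by rewrite [ln (_ * expR 1)]lnM ?posrE ?expR_gt0// expRK ln_powR.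
have -> : m2 / (2 * v) = K%:R / 2 by rewrite /v; field; rewrite !gt_eqF.
move: (ln (2 * pi)) (ln v) (ln C) => lp lv lC.
by field; rewrite !gt_eqF.
Qed.

(** The terms in ln C and ln (2 pi) cancel, so only the ratio v / s^2 remains; [kappa] is the
    prefactor of the bound times K / 2. *)
Lemma init_bound_sub_min s : 0 < s ->
  f s - f s0 = kappa * (v / s ^+ 2 - 1 - ln (v / s ^+ 2)).
Proof.
move=> sp; have s2 : s0 ^+ 2 = v by rewrite sqr_sqrtr// ltW.
have sp2 : 0 < s ^+ 2 by rewrite exprn_gt0.
rewrite /f /init_bound s2 ln_div ?posrE//.
have pi2 : 0 < 2 * pi :> R by rewrite mulr_gt0 ?pi_gt0.
have -> : ln (2 * pi * v) = ln (2 * pi) + ln v by rewrite lnM ?posrE.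
have -> : ln (2 * pi * s ^+ 2) = ln (2 * pi) + ln (s ^+ 2).
  by rewrite lnM ?posrE.
have -> : m2 / (2 * v) = K%:R / 2 by rewrite /v; field; rewrite !gt_eqF.
move: (ln (2 * pi)) (ln v) (ln (s ^+ 2)) (ln C) => lp lv ls lC.
by rewrite /kappa /v; field; rewrite !gt_eqF.
Qed.

Lemma optimal_std_init_bound s : optimal_std f s <-> s = s0.
Proof.
split=> [[sp fs]|->].
  have sp2 : 0 < s ^+ 2 by rewrite exprn_gt0.
  (* Comparing with the competitor [s0] gives t - 1 <= ln t for t = v / s^2, which forces t = 1. *)
  have := fs _ s0_gt0; rewrite -subr_le0 init_bound_sub_min// pmulr_rle0//.
  rewrite subr_le0 => /(subr1_le_ln (divr_gt0 v0 sp2)) => vs.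
  have vE : v = s ^+ 2 by rewrite -[LHS](divfK (lt0r_neq0 sp2)) vs mul1r.
  by rewrite /s0 vE sqrtr_sqr ger0_norm// ltW.
split=> // s' sp; rewrite -subr_ge0 init_bound_sub_min// pmulr_rge0//.
by rewrite subr_ge0; apply: ln_le_subr1; rewrite divr_gt0// exprn_gt0.
Qed.

(** This allows C^(2 / K) to be replaced by a larger constant. *)
Lemma optimized_bound_le c d : 0 < c -> c <= d ->
  optimized_bound alpha b sigma c v <= optimized_bound alpha b sigma d v.
Proof.
move=> c0 cd; have d0 := lt_le_trans c0 cd.
have e0 : 0 < 2 * pi * expR 1 :> R by rewrite !mulr_gt0 ?pi_gt0 ?expR_gt0.
rewrite /optimized_bound ler_pM2l// lerD2l ler_ln ?posrE ?(mulr_gt0 e0)//.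
by rewrite ler_pM2l.
Qed.

End init_bound_minimum.

(** * The bounds for the stationary law of the model *)

Theorem mainTheorem2 (R : realType) (K : nat) (alpha b sigma : R)
    (A : 'M[R]_K) (C1loc sigma0 : R) (Pss P0 : probability (Rn R K) R)
    (hK : (1 <= K)%N) (halpha : 0 < alpha) (hb : 0 < b) (hsigma : 0 < sigma)
    (hA : posdef A)
    (hPss : is_density Pss (p_ss alpha b sigma A C1loc))
    (hsigma0 : 0 < sigma0)
    (hP0 : is_density P0 (p_0 sigma0)) :
  let ELbar := expect Pss (mean_loss A) in
  let m2 := expect Pss sqnorm in
  let Vbar := avg_variance Pss in
  let bound0 := init_bound K alpha b sigma C1loc m2 in
  let opt := optimized_bound alpha b sigma in
  let c := C1loc `^ (2 / K%:R) in
  [/\ ELbar <= bound0 sigma0,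
      optimal_std bound0 sigma0 <-> sigma0 = Num.sqrt (m2 / K%:R),
      Num.sqrt (m2 / K%:R) = Num.sqrt Vbar,
      ELbar <= opt c (m2 / K%:R) /\
        (optimal_std bound0 sigma0 -> bound0 sigma0 = opt c (m2 / K%:R)) /\
        (c <= C1loc -> ELbar <= opt C1loc (m2 / K%:R)) &
      mean_zero Pss ->
        ELbar <= opt c Vbar /\
        (optimal_std bound0 sigma0 -> bound0 sigma0 = opt c Vbar) /\
        (c <= C1loc -> ELbar <= opt C1loc Vbar)].
Proof.
move=> ELbar m2 Vbar bound0 opt c.
pose q := 2 * b / (alpha * sigma ^+ 2).
have s2 : 0 < sigma ^+ 2 by rewrite exprn_gt0.
have q0 : 0 < q by rewrite divr_gt0// mulr_gt0.
have KR : 0 < K%:R :> R by rewrite ltr0n.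
have dP : is_density Pss (fun W => C1loc * expR (- (q * loss A W))).
  suff <- : p_ss alpha b sigma A C1loc =
    (fun W => C1loc * expR (- (q * loss A W))) by [].
  by apply/funext => W; rewrite /p_ss /q mulrAC.
have C0 := normalizing_constant_gt0 dP.
have m20 : 0 < m2 by exact: expect_sqnorm_gt0 hK q0 hA dP.
have VE : Vbar = m2 / K%:R by exact: avg_varianceE hK q0 hA dP.
have bound s : 0 < s -> ELbar <= bound0 s.
  move=> sp; have := relative_entropy_bound hK q0 hA dP sp.
  have -> : ELbar = expect Pss (loss A) / K%:R.
    rewrite /ELbar !expectE /mean_loss RintegralZr//.
    exact: integrable_loss hK q0 hA dP.
  rewrite /bound0 /init_bound -/m2; set B := (X in _ <= X) => h.
  (* This prefactor turns the bound on q E[L] into one on E[L] / K. *)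
  have -> : alpha * sigma ^+ 2 / (2 * b * K%:R) = q^-1 / K%:R.
    by rewrite /q; field; rewrite !gt_eqF.
  by rewrite mulrAC ler_pM2r ?invr_gt0// ler_pdivlMl.
have bound_sqrt : bound0 (Num.sqrt (m2 / K%:R)) = opt c (m2 / K%:R).
  exact: init_bound_sqrt.
have optE : optimal_std bound0 sigma0 <-> sigma0 = Num.sqrt (m2 / K%:R).
  exact: optimal_std_init_bound.
have ELc : ELbar <= opt c (m2 / K%:R).
  by rewrite -bound_sqrt; apply: bound; rewrite sqrtr_gt0 divr_gt0.
have bound_opt : optimal_std bound0 sigma0 -> bound0 sigma0 = opt c (m2 / K%:R).
  by move=> /optE ->.
have ELC : c <= C1loc -> ELbar <= opt C1loc (m2 / K%:R).
  move=> cC; apply: le_trans ELc _; apply: optimized_bound_le => //.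
  by rewrite powR_gt0.
by rewrite VE; split => //; exact: bound.
Qed.
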